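(* Let $(X_n)_{n\geq 1}$ be a sequence of real-valued random variables on a probability space $(\Omega,\mathcal{F},P)$ (not necessarily identically distributed) such that $P(|X_n|\geq x)\leq P(|X_1|\geq x)$ for all $x\geq 0$ and all $n\geq 1$. For $t\in[-\pi,\pi)$ let $S_n(t)=\sum_{k=1}^{n}e^{ikt}X_k$. (i) If $E|X_1|<\infty$, then for almost all $t\in[-\pi,\pi)$, $\lim_{n\to\infty} S_n(t)/n=0$ $P$-a.s. (ii) If $1<p<2$, $1\leq r\leq p$ and $E|X_1|^p<\infty$, then for every $\epsilon>0$ and for almost all $t\in[-\pi,\pi)$, $$\sum_{n=1}^{\infty}n^{p/r-2}\,P\left[\max_{1\leq k\leq n}|S_k(t)|>\epsilon n^{1/r}\right]<\infty.$$ (iii) If $1<p<2$ and $E|X_1|^p<\infty$, then for almost all $t\in[-\pi,\pi)$, $\lim_{n\to\infty} S_n(t)/n^{1/p}=0$ $P$-a.s.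
   Context: ''Almost all $t$'' is with respect to Lebesgue measure on $[-\pi,\pi)$; the $P$-null sets may depend on $t$. No independence or other dependence assumption is made on the sequence $(X_n)$. Here $i$ denotes the imaginary unit. *)

(* Defs.v *)
From HB Require Import structures.
From mathcomp Require Import all_boot all_order all_algebra.
From mathcomp Require Import complex.
From mathcomp Require Import all_classical all_reals all_analysis.

Set Implicit Arguments.
Unset Strict Implicit.
Unset Printing Implicit Defensive.

Import Order.TTheory GRing.Theory Num.Theory.
Import numFieldNormedType.Exports.

Local Open Scope ring_scope.
Local Open Scope complex_scope.

(* e^{ix} for real x *)
Definition expi (R : realType) (x : R) : R[i] := cos x +i* sin x.

(* [R[i]^o] is [R[i]] with the norm topology of a numeric field. The sequence
   is indexed from 1: X 0 is never used. *)
Definition trig_sum (R : realType) (T : Type) (X : nat -> T -> R)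
    (n : nat) (t : R) (w : T) : R[i]^o :=
  \sum_(1 <= k < n.+1) expi (k%:R * t) * (X k w)%:C.

(* The modulus [Normc.normc] takes values in R, whereas `|z| lives in
   R[i]. The default value 0 of the maximum is harmless, moduli being >= 0. *)
Definition max_trig_sum (R : realType) (T : Type) (X : nat -> T -> R)
    (n : nat) (t : R) (w : T) : R :=
  \big[Num.max/0]_(1 <= k < n.+1) Normc.normc (trig_sum X k t w).

(* Main.v *)
Require Import Defs.
From mathcomp Require Import all_boot all_order all_algebra.
From mathcomp Require Import complex.
From mathcomp Require Import all_classical all_reals all_analysis.
From mathcomp Require Import measurable_realfun ring lra.

Set Implicit Arguments.
Unset Strict Implicit.
Unset Printing Implicit Defensive.

Import Order.TTheory GRing.Theory Num.Theory.
Import numFieldNormedType.Exports.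

Local Open Scope classical_set_scope.
Local Open Scope ring_scope.
Local Open Scope complex_scope.

(** No independence is available, so everything rests on the exponentials
    [e^{ikt}] being orthogonal in [t]: one averages over [t] first, for each
    fixed sample point, and only then takes expectations.

    Since [p < 2], a maximal inequality much weaker than Carleson-Hunt is enough.
    Fix [p < q < 2]. Parseval bounds the square integral over [t] of a block sum
    [\sum_(m <= k < n) a_k e^{ikt}] by [2 pi \sum a_k^2], hence by
    [2 pi (\sum |a_k|^q)^{2/q}]. The exponent [2/q] exceeds 1, and this gain makes
    a bisection argument converge: cutting an interval in two halves of equal
    [q]-mass and recursing gives [prefix_max_L2], a bound of the same shape for the
    maximum over all prefixes, with no logarithmic loss. By Chebyshev, and because
    the circle has finite measure, this becomes the weak type estimate
    [max_block_weak_type]: the set of [t] at which some prefix sum up to [n]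
    exceeds [x] has measure at most [C \sum_(k <= n) min (1, (|a_k| / x)^q)].

    Integrating over the sample space and exchanging the integrals, the measure in
    [t] becomes the integral over [t] of the probability that the maximum exceeds
    [x]. As [min (1, (u / x)^q)] is nondecreasing in [u], each
    [|X_k|] may be replaced by [|X_1|] ([stochastic_domination_min]). With
    [x = eps n^{1/r}] and weights [n^{p/r-2}], the sum over [n] of these bounds is,
    by [sum_powR_min_le], at most a constant times [E|X_1|^p]. Thus the series of (ii)
    has a finite integral over [t], so it is finite for almost every [t]
    ([ae_tail_series_lty]).

    This argument also covers [p = 1]. For [r = p] the weights are [1/n], and
    finiteness of the series says that for almost every sample point the set of [n]
    at which the maximum exceeds [eps n^{1/p}] has a finite sum of reciprocals. The
    maximum being nondecreasing in [n], one exceedance of twice that level at [N]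
    would force exceedances from [N] to [2 N - 1] and contribute at least 1/2 to the
    sum; so they stop ([series_inv_lty_growth]). This gives (iii), and (i) as its
    case [p = 1]. *)

(** * Maxima of prefix sums: the bisection argument *)

Definition prefix_max (R : realType) (T : Type) (f : nat -> nat -> T -> R)
    (m n : nat) (x : T) : R :=
  \big[Num.max/0]_(m <= k < n) f m k.+1 x.

Lemma bigmax_nat_le (R : realType) (F : nat -> R) (m n : nat) (c : R) :
  0 <= c -> (forall k, (m <= k < n)%N -> F k <= c) ->
  \big[Num.max/0]_(m <= k < n) F k <= c.
Proof.
move=> c0 Fc; rewrite big_nat; apply: (big_ind (fun y => y <= c)) => //.
by move=> x y xc yc; rewrite ge_max xc yc.
Qed.

Lemma bigmax_nat_sup (R : realType) (F : nat -> R) (m n k : nat) :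
  (m <= k < n)%N -> F k <= \big[Num.max/0]_(m <= j < n) F j.
Proof.
rewrite -mem_index_iota; elim: (index_iota m n) => // i s ih.
rewrite in_cons big_cons le_max => /predU1P[->|/ih ->]; first by rewrite lexx.
by rewrite orbT.
Qed.

Lemma bigmax_nat_ge0 (R : realType) (F : nat -> R) (m n : nat) :
  0 <= \big[Num.max/0]_(m <= k < n) F k.
Proof.
apply: (big_rec (fun y => 0 <= y)) => // k x _ x0.
by rewrite le_max x0 orbT.
Qed.

Lemma measurable_bigmax_nat (R : realType) d (T : measurableType d)
    (F : nat -> T -> R) (m n : nat) :
  (forall k, measurable_fun setT (F k)) ->
  measurable_fun setT (fun x => \big[Num.max/0]_(m <= k < n) F k x).
Proof.
move=> mF; elim: (index_iota m n) => [|k s ih].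
  by under eq_fun do rewrite big_nil; exact: measurable_cst.
under eq_fun do rewrite big_cons.
exact: measurable_maxr.
Qed.

Lemma measurable_superlevel (R : realType) d (T : measurableType d)
    (f : T -> R) (x : R) :
  measurable_fun setT f -> measurable [set z | x < f z].
Proof.
move=> mf; rewrite -[X in measurable X]setTI.
have -> : [set z | x < f z] = f @^-1` `]x, +oo[.
  by apply/seteqP; split => t /=; rewrite in_itv/= andbT.
exact: mf.
Qed.

(** The cut is at the first index where the accumulated mass reaches one half; that
    index itself, whose mass may be large, belongs to neither side. *)
Lemma half_mass_split (R : realType) (w : nat -> R) (m n : nat) :
  (forall k, 0 <= w k) -> (m < n)%N ->
  exists j, [/\ (m <= j < n)%N,
    \sum_(m <= k < j) w k <= (\sum_(m <= k < n) w k) / 2 &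
    \sum_(j.+1 <= k < n) w k <= (\sum_(m <= k < n) w k) / 2].
Proof.
move=> w0 mn; set W := \sum_(m <= k < n) w k.
have W0 : 0 <= W by apply: sumr_ge0.
pose Q j := (m <= j)%N && (W / 2 <= \sum_(m <= k < j.+1) w k).
have exQ : exists j, Q j.
  exists n.-1; rewrite /Q (ltn_predK mn) -ltnS (ltn_predK mn) mn/= -/W.
  by lra.
case: (ex_minnP exQ) => j /andP[mj Wj] jmin.
have jn : (j < n)%N.
  have : (j <= n.-1)%N.
    apply: jmin; rewrite /Q (ltn_predK mn) -ltnS (ltn_predK mn) mn/= -/W.
    by lra.
  by rewrite -ltnS (ltn_predK mn).
exists j; split; first by rewrite mj.
- have [jm|mj'] := leqP j m; first by rewrite big_geq ?divr_ge0.
  rewrite leNgt; apply/negP => h.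
  have : (j <= j.-1)%N.
    apply: jmin; rewrite /Q (ltn_predK mj') -ltnS (ltn_predK mj') mj'/=.
    exact: ltW.
  by rewrite -ltnS (ltn_predK mj') ltnn.
- have : W = \sum_(m <= k < j.+1) w k + \sum_(j.+1 <= k < n) w k.
    by rewrite /W (big_cat_nat (n := j.+1))//= leqW.
  by move=> WE; move: Wj; rewrite WE; lra.
Qed.

(** The reciprocals of the two weights add up to 1, so the difference of the two
    sides is a square up to a positive factor. The weights are chosen so that the
    second one, multiplied by [rho], is [(1 + rho) / 2 < 1]. *)
Lemma sqrrD_weighted (R : realType) (rho a b : R) : 0 < rho < 1 ->
  (a + b) ^+ 2 <= (1 + rho) / (1 - rho) * a ^+ 2 +
                  (1 + rho) / (2 * rho) * b ^+ 2.
Proof.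
move=> /andP[r0 r1]; rewrite -subr_ge0.
rewrite (_ : _ - _ =
  (2 * rho * a - (1 - rho) * b) ^+ 2 / (2 * rho * (1 - rho))).
  by rewrite divr_ge0 ?sqr_ge0// !mulr_ge0 ?subr_ge0// ltW.
by field; rewrite subr_eq0 !gt_eqF.
Qed.

(** For [al > 1] the factor [2 `^ (1 - al)] is less than 1: this is the contraction
    gained by halving the mass. *)
Lemma powR_half_double (R : realType) (al W : R) : 0 <= W ->
  (W / 2) `^ al + (W / 2) `^ al = 2 `^ (1 - al) * W `^ al.
Proof.
move=> W0; rewrite powRM// ?invr_ge0//.
have -> : 2^-1 `^ al = 2 `^ (- al) :> R.
  by rewrite powRN -powR_inv1// -powRrM mulN1r powRN.
rewrite powRD; last by apply/implyP; rewrite pnatr_eq0.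
by rewrite powRr1//; ring.
Qed.

(** A prefix stops short of the index [j], or ends with it, or runs past it into
    the right part. *)
Lemma prefix_max_split (R : realType) (T : Type) (f : nat -> nat -> T -> R)
    (m j n : nat) (x : T) :
  (forall m n x, 0 <= f m n x) ->
  (forall m j n x, (m <= j <= n)%N -> f m n x <= f m j x + f j n x) ->
  (m <= j < n)%N ->
  prefix_max f m n x <=
    f m j.+1 x + Num.max (prefix_max f m j x) (prefix_max f j.+1 n x).
Proof.
move=> f0 fD /andP[mj jn]; rewrite /prefix_max.
set b := (X in Num.max X _); set c := (X in Num.max _ X).
have b0 : 0 <= b by exact: bigmax_nat_ge0.
have : b <= Num.max b c /\ c <= Num.max b c.
  by rewrite !le_max !lexx orbT.
move: (Num.max b c) => M [bM cM].
apply: bigmax_nat_le => [|k /andP[mk kn]].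
  by rewrite addr_ge0// (le_trans b0).
have := f0 m j.+1 x => fj0.
have [kj|jk|->] := ltngtP k j; last by lra.
- have : f m k.+1 x <= b.
    by rewrite /b; apply: (@bigmax_nat_sup _ (fun k => f m k.+1 x)); rewrite mk.
  by lra.
- have : f j.+1 k.+1 x <= c.
    by rewrite /c; apply: (@bigmax_nat_sup _ (fun k => f j.+1 k.+1 x)); rewrite jk.
  have : f m k.+1 x <= f m j.+1 x + f j.+1 k.+1 x.
    by apply: fD; rewrite !ltnS (leq_trans mj)// ltnW.
  by lra.
Qed.

(** Moricz's maximal inequality, by induction on the length of the interval.
    Splitting at half mass, the square of the maximum over the prefixes is at most
    [c f(m, j+1)^2] plus [e] times the squares of the two sub-maxima (a maximum of
    two squares being at most their sum). The hypothesis bounds the first term by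
    [c B W^al], the induction the others by
    [2 e K (W / 2)^al = (1 + rho) / 2 K W^al], so a constant [K] with
    [c B + (1 + rho) / 2 K = K] is preserved. That [K] is chosen before [f] and [w]
    is essential for the application, where both vary with the sample point. *)
Lemma prefix_max_L2 (R : realType) d (T : measurableType d)
    (mu : {measure set T -> \bar R}) (D : set T) (al B : R) :
  measurable D -> 1 < al -> 0 <= B ->
  exists2 K : R, 0 <= K & forall (f : nat -> nat -> T -> R) (w : nat -> R),
    (forall m n x, 0 <= f m n x) ->
    (forall m n, measurable_fun setT (f m n)) ->
    (forall m j n x, (m <= j <= n)%N -> f m n x <= f m j x + f j n x) ->
    (forall k, 0 <= w k) ->
    (forall m n, (\int[mu]_(x in D) (f m n x ^+ 2)%:E <=
       (B * (\sum_(m <= k < n) w k) `^ al)%:E)%E) ->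
    forall m n, (\int[mu]_(x in D) (prefix_max f m n x ^+ 2)%:E <=
       (K * (\sum_(m <= k < n) w k) `^ al)%:E)%E.
Proof.
move=> mD al1 B0.
pose rho : R := 2 `^ (1 - al).
have rho0 : 0 < rho by rewrite powR_gt0.
have rho1 : rho < 1.
  rewrite /rho /powR pnatr_eq0/= expR_lt1 pmulr_llt0 ?subr_lt0//.
  by rewrite ln_gt0// ltr1n.
have rho01 : 0 < rho < 1 by rewrite rho0.
pose c := (1 + rho) / (1 - rho).
pose e := (1 + rho) / (2 * rho).
have c0 : 0 <= c by rewrite divr_ge0//; lra.
have e0 : 0 <= e by rewrite divr_ge0//; lra.
(* The fixed point of the recursion on the constant. *)
have [K K0 KE] : exists2 K : R, 0 <= K & c * B + (1 + rho) / 2 * K = K.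
  exists (2 * B * c / (1 - rho)).
    apply: divr_ge0; last by lra.
    by apply: mulr_ge0 => //; apply: mulr_ge0.
  by field; rewrite subr_eq0 gt_eqF.
exists K => // f w f0 mf fD w0 fB m n.
have mM m' n' : measurable_fun setT (prefix_max f m' n').
  exact: measurable_bigmax_nat.
have mE (g : T -> R) : measurable_fun setT g ->
    measurable_fun D (fun x => (g x ^+ 2)%:E).
  move=> mg; apply/measurable_EFinP; apply: measurable_funX.
  exact: measurable_funTS.
have mZ r (g : T -> R) : measurable_fun setT g ->
    measurable_fun D (fun x => (r%:E * (g x ^+ 2)%:E)%E).
  by move=> mg; apply: measurable_funeM; exact: mE.
have [N] : exists N, (n - m <= N)%N by exists (n - m)%N.
elim: N m n => [|N ih] m n nm.
  rewrite integral0_eq ?lee_fin ?mulr_ge0 ?powR_ge0// => x _.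
  by rewrite /prefix_max big_geq ?expr0n//= -subn_eq0 -leqn0.
have [nm'|mn] := leqP n m.
  rewrite integral0_eq ?lee_fin ?mulr_ge0 ?powR_ge0// => x _.
  by rewrite /prefix_max big_geq ?expr0n.
have [j [/andP[mj jn] Wl Wr]] := half_mass_split w0 mn.
set W := \sum_(m <= k < n) w k in Wl Wr *.
have W0 : 0 <= W by apply: sumr_ge0.
have sq0 (y : R) : (0 <= (y ^+ 2)%:E)%E by rewrite lee_fin sqr_ge0.
have al0 : 0 <= al by lra.
have half (V : R) : 0 <= V -> V <= W / 2 ->
    ((K * V `^ al)%:E <= (K * (W / 2) `^ al)%R%:E)%E.
  move=> V0 VW; rewrite lee_fin ler_wpM2l// ge0_ler_powR ?nnegrE// divr_ge0//.
have jN : (j - m <= N)%N.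
  by rewrite -ltnS (leq_trans _ nm)// ltn_sub2r.
have nN : (n - j.+1 <= N)%N.
  by rewrite -ltnS (leq_trans _ nm)// ltn_sub2l// ltnS.
apply: (@le_trans _ _ (\int[mu]_(x in D)
   (c%:E * (f m j.+1 x ^+ 2)%:E + (e%:E * (prefix_max f m j x ^+ 2)%:E +
    e%:E * (prefix_max f j.+1 n x ^+ 2)%:E)))%E).
  apply: ge0_le_integral => //.
  - exact: mE.
  - apply: emeasurable_funD; first exact: mZ.
    by apply: emeasurable_funD; exact: mZ.
  move=> x _; rewrite -!EFinM -!EFinD lee_fin.
  set a := f m j.+1 x; set b := prefix_max f m j x.
  set b' := prefix_max f j.+1 n x.
  have b0 : 0 <= b by exact: bigmax_nat_ge0.
  have b'0 : 0 <= b' by exact: bigmax_nat_ge0.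
  apply: (@le_trans _ _ ((a + Num.max b b') ^+ 2)).
    rewrite ler_sqr ?nnegrE ?bigmax_nat_ge0 ?addr_ge0 ?f0 ?le_max ?b0//.
    by apply: prefix_max_split => //; rewrite mj.
  apply: (le_trans (sqrrD_weighted a (Num.max b b') rho01)).
  rewrite -/c -/e lerD2l -mulrDr ler_wpM2l//.
  by case: (leP b b') => _; rewrite ?lerDl ?lerDr sqr_ge0.
rewrite ge0_integralD//; last 4 first.
- by move=> x _; rewrite mule_ge0 ?lee_fin ?sqr_ge0.
- exact: mZ.
- by move=> x _; rewrite adde_ge0 ?mule_ge0 ?lee_fin ?sqr_ge0.
- by apply: emeasurable_funD; exact: mZ.
rewrite ge0_integralD//; last 4 first.
- by move=> x _; rewrite mule_ge0 ?lee_fin ?sqr_ge0.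
- exact: mZ.
- by move=> x _; rewrite mule_ge0 ?lee_fin ?sqr_ge0.
- exact: mZ.
rewrite !ge0_integralZl_EFin//; do ?exact: mE.
have step1 := fB m j.+1.
have step2 := le_trans (ih m j jN) (half _ (sumr_ge0 _ (fun _ _ => w0 _)) Wl).
have step3 := le_trans (ih j.+1 n nN) (half _ (sumr_ge0 _ (fun _ _ => w0 _)) Wr).
have Wj : \sum_(m <= k < j.+1) w k <= W.
  by rewrite /W [leRHS](big_cat_nat (n := j.+1)) ?leqW//= lerDl sumr_ge0.
have {}step1 : (\int[mu]_(x in D) (f m j.+1 x ^+ 2)%:E <= (B * W `^ al)%:E)%E.
  apply: (le_trans step1); rewrite lee_fin ler_wpM2l// ge0_ler_powR ?nnegrE//.
  exact: sumr_ge0.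
apply: (@le_trans _ _ (c%:E * (B * W `^ al)%:E +
  (e%:E * (K * (W / 2) `^ al)%R%:E + e%:E * (K * (W / 2) `^ al)%R%:E))%E).
  by rewrite !leeD// lee_wpmul2l// lee_fin.
rewrite -!EFinM -!EFinD lee_fin -!mulrDr powR_half_double// -/rho.
(* [2 * (W / 2)^al = rho * W^al] and [e * rho = (1 + rho) / 2]. *)
rewrite (_ : _ + _ = (c * B + (1 + rho) / 2 * K) * W `^ al).
  by rewrite KE.
by rewrite /e; field; rewrite gt_eqF.
Qed.

(** * Trigonometric block sums and Parseval *)

Lemma normc_trig_sum (R : realType) (a : nat -> R) (m n : nat) (t : R) :
  Normc.normc (\sum_(m <= k < n) expi (k%:R * t) * (a k)%:C) =
  Num.sqrt ((\sum_(m <= k < n) a k * cos (k%:R * t)) ^+ 2 +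
            (\sum_(m <= k < n) a k * sin (k%:R * t)) ^+ 2).
Proof.
suff -> : \sum_(m <= k < n) expi (k%:R * t) * (a k)%:C =
  (\sum_(m <= k < n) a k * cos (k%:R * t)) +i*
  (\sum_(m <= k < n) a k * sin (k%:R * t)) by [].
elim: (index_iota m n) => [|k s ih]; first by rewrite !big_nil.
rewrite !big_cons ih /expi; simpc.
by rewrite -/(@Algebra.add _); congr (_ +i* _); rewrite mulrC.
Qed.

(** [|\sum_(m <= k < n) a_k e^{ikt}|], so that [prefix_max (block_modulus a) 1 n.+1]
    is the maximum of the moduli of the first [n] partial sums. *)
Definition block_modulus (R : realType) (a : nat -> R) (m n : nat) (t : R) : R :=
  Normc.normc (\sum_(m <= k < n) expi (k%:R * t) * (a k)%:C).

Lemma block_modulus_ge0 (R : realType) (a : nat -> R) (m n : nat) (t : R) :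
  0 <= block_modulus a m n t.
Proof. by rewrite /block_modulus normc_trig_sum sqrtr_ge0. Qed.

Lemma block_modulusD (R : realType) (a : nat -> R) (m j n : nat) (t : R) :
  (m <= j <= n)%N ->
  block_modulus a m n t <= block_modulus a m j t + block_modulus a j n t.
Proof.
move=> /andP[mj jn]; rewrite /block_modulus (big_cat_nat (n := j))//=.
exact: le_normcD.
Qed.

(** The coefficients and the point [t] both depend on [u], which covers at once
    measurability in [t], in the sample point, and in the pair of them. *)
Lemma measurable_block_modulus (R : realType) d (U : measurableType d)
    (a : nat -> U -> R) (th : U -> R) (m n : nat) :
  (forall k, measurable_fun setT (a k)) -> measurable_fun setT th ->
  measurable_fun setT (fun u => block_modulus (a ^~ u) m n (th u)).
Proof.
move=> ma mth; rewrite /block_modulus.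
under eq_fun do rewrite normc_trig_sum.
have mS (g : R -> R) : measurable_fun setT g ->
    measurable_fun setT (fun u => \sum_(m <= k < n) a k u * g (k%:R * th u)).
  move=> mg; apply: measurable_sum => k; apply: measurable_funM => //.
  by apply: measurableT_comp => //; apply: measurable_funM.
have msqrt : measurable_fun setT (@Num.sqrt R).
  by apply: continuous_measurable_fun; exact: sqrt_continuous.
apply: (measurableT_comp msqrt).
apply: measurable_funD; apply: measurable_funX; apply: mS.
  by apply: continuous_measurable_fun; exact: continuous_cos.
by apply: continuous_measurable_fun; exact: continuous_sin.
Qed.

Lemma sin_natpi (R : realType) (n : nat) : sin (n%:R * pi) = 0 :> R.
Proof.
elim: n => [|n ih]; first by rewrite mul0r sin0.
by rewrite -natr1 mulrDl mul1r sinDpi ih oppr0.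
Qed.

Lemma continuous_cosM (R : realType) (c : R) : continuous (fun t : R => cos (c * t)).
Proof.
move=> t; apply: (@continuous_comp _ _ _ ( *%R c) (@cos R)).
  exact: mulrl_continuous.
exact: continuous_cos.
Qed.

(** The closed interval is a compact set on which the fundamental theorem of
    calculus applies directly; its extra endpoint is harmless. *)
Definition circle (R : realType) : set R := `[- pi, pi]%classic.
Arguments circle R : clear implicits.

Lemma measurable_circle (R : realType) : measurable (circle R).
Proof. exact: measurable_itv. Qed.

Lemma lebesgue_measure_circle (R : realType) :
  lebesgue_measure (circle R) = (2 * pi)%:E.
Proof.
rewrite /circle lebesgue_measure_itv/= lte_fin gtrN ?pi_gt0//.
by rewrite -EFinB opprK mulr_natl mulr2n.
Qed.

Lemma integral_cos_natB (R : realType) (j k : nat) :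
  (\int[lebesgue_measure]_(t in circle R) (cos ((j%:R - k%:R) * t : R))%:E =
   (if j == k then 2 * pi else 0)%R%:E)%E.
Proof.
have pi0 : 0 < pi :> R by exact: pi_gt0.
have [->|jk] := eqVneq j k.
  under eq_integral do rewrite subrr mul0r cos0.
  rewrite integral_cst; last exact: measurable_circle.
  by rewrite mul1e; exact: lebesgue_measure_circle.
set c := _ - _.
have c0 : c != 0 by rewrite subr_eq0 eqr_nat.
have dF (t : R) : is_derive t 1 (fun t => c^-1 * sin (c * t)) (cos (c * t)).
  have -> : (fun t => c^-1 * sin (c * t)) = c^-1 *: (sin \o (c *: id)) by [].
  apply: is_derive_eq.
  by rewrite /GRing.scale/= mulr1 mulrCA mulVf ?mulr1.
have cF : continuous (fun t => c^-1 * sin (c * t) : R).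
  move=> t; apply: differentiable_continuous; apply/derivable1_diffP.
  by case: (dF t).
rewrite /circle (@continuous_FTC2 _ _ (fun t => c^-1 * sin (c * t))) ?gtrN//.
- have sc : sin (c * pi) = 0.
    by rewrite mulrBl sinB !sin_natpi mul0r mulr0 subrr.
  by rewrite mulrN sinN sc oppr0 mulr0 subee.
- by apply: continuous_subspaceT; exact: continuous_cosM.
- split => [t _||]; first by case: (dF t).
  + by apply: cvg_at_right_filter; exact: cF.
  + by apply: cvg_at_left_filter; exact: cF.
- by move=> t _; rewrite derive1E derive_val.
Qed.

Lemma sqr_block_modulus (R : realType) (a : nat -> R) (m n : nat) (t : R) :
  block_modulus a m n t ^+ 2 =
  \sum_(m <= j < n) \sum_(m <= k < n) a j * a k * cos ((j%:R - k%:R) * t).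
Proof.
rewrite /block_modulus normc_trig_sum sqr_sqrtr ?addr_ge0 ?sqr_ge0//.
rewrite !expr2 !big_distrlr -big_split/=; apply: eq_bigr => j _.
rewrite -big_split/=; apply: eq_bigr => k _.
by rewrite mulrBl cosB; ring.
Qed.

Lemma block_modulus_parseval (R : realType) (a : nat -> R) (m n : nat) :
  (\int[lebesgue_measure]_(t in circle R) (block_modulus a m n t ^+ 2)%:E =
   (2 * pi * \sum_(m <= k < n) a k ^+ 2)%R%:E)%E.
Proof.
pose g j k (t : R) := ((a j * a k)%:E * (cos ((j%:R - k%:R) * t))%:E)%E.
have mC := @measurable_circle R.
have icos (j k : nat) : lebesgue_measure.-integrable (circle R)
    (fun t : R => (cos ((j%:R - k%:R) * t))%:E).
  apply: continuous_compact_integrable; first exact: segment_compact.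
  by apply: continuous_subspaceT; exact: continuous_cosM.
have ig j k : lebesgue_measure.-integrable (circle R) (g j k).
  by apply: integrableZl.
transitivity (\int[lebesgue_measure]_(t in circle R)
    \sum_(m <= j < n) \sum_(m <= k < n) g j k t)%E.
  apply: eq_integral => t _; rewrite sqr_block_modulus -sumEFin.
  by apply: eq_bigr => j _; rewrite -sumEFin.
rewrite integral_sum//; last first.
  by move=> j; apply: integrable_sum.
rewrite big_distrr/= -sumEFin; apply: eq_big_nat => j mjn.
rewrite integral_sum// (bigD1_seq j) ?mem_index_iota ?iota_uniq//=.
rewrite integralZl// integral_cos_natB eqxx big1_seq ?adde0.
  by rewrite -EFinM; congr EFin; ring.
move=> k /andP[kj _]; rewrite integralZl// integral_cos_natB.
by rewrite eq_sym (negbTE kj) mule0.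
Qed.

(** * The weak type maximal inequality *)

(** Each [w k `^ al] is [w k] times [w k `^ (al - 1)], and the second factor is at
    most the same power of the total mass. *)
Lemma sum_powR_le (R : realType) (w : nat -> R) (m n : nat) (al : R) :
  1 <= al -> (forall k, 0 <= w k) ->
  \sum_(m <= k < n) w k `^ al <= (\sum_(m <= k < n) w k) `^ al.
Proof.
move=> al1 w0; set W := \sum_(m <= k < n) w k.
have al0 : 0 < al by lra.
have W0 : 0 <= W by exact: sumr_ge0.
have wW k : (m <= k < n)%N -> w k <= W.
  move=> mkn; rewrite /W (bigD1_seq k) ?mem_index_iota ?iota_uniq//=.
  by rewrite lerDl sumr_ge0.
rewrite -mulr_powRB1// mulr_suml; apply: ler_sum_nat => k mkn.
rewrite -mulr_powRB1// ler_wpM2l// ge0_ler_powR ?nnegrE ?wW//.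
by lra.
Qed.

Lemma block_modulus_L2 (R : realType) (q : R) (a : nat -> R) (m n : nat) :
  0 < q < 2 ->
  (\int[lebesgue_measure]_(t in circle R) (block_modulus a m n t ^+ 2)%:E <=
   (2 * pi * (\sum_(m <= k < n) `|a k| `^ q) `^ (2 / q))%R%:E)%E.
Proof.
move=> /andP[q0 q2]; rewrite block_modulus_parseval lee_fin.
rewrite ler_wpM2l ?mulr_ge0 ?pi_ge0//.
have q1 : 1 <= 2 / q by rewrite ler_pdivlMr// mul1r ltW.
apply: le_trans (sum_powR_le _ _ q1 (fun k => powR_ge0 _ _)).
apply: ler_sum => k _; rewrite -powRrM mulrC divfK ?gt_eqF//.
by rewrite powR_mulrn// real_normK ?num_real.
Qed.

(** Write [S] for the sum on the right. If [S >= 1], the measure of the whole circle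
    is a sufficient bound. If [S < 1], no term is truncated, Chebyshev and the
    maximal inequality give [K S^{2/q}], and [S^{2/q} <= S]. The truncation by 1
    thus costs nothing, and it replaces a truncation of the random variables. *)
Lemma max_block_weak_type (R : realType) (q : R) : 0 < q < 2 ->
  exists2 C : R, 0 <= C & forall (a : nat -> R) (n : nat) (x : R), 0 < x ->
    (lebesgue_measure (circle R `&`
       [set t | x < prefix_max (block_modulus a) 1 n.+1 t]%R) <=
     (C * \sum_(1 <= k < n.+1) Num.min 1 ((`|a k| / x) `^ q))%R%:E)%E.
Proof.
move=> /[dup] q02 /andP[q0 q2]; have al1 : 1 < 2 / q.
  by rewrite ltr_pdivlMr// mul1r.
have B0 : 0 <= 2 * pi :> R by rewrite mulr_ge0// pi_ge0.
have [K K0 HK] := prefix_max_L2 (@lebesgue_measure R) (@measurable_circle R) al1 B0.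
exists (K + 2 * pi); first by rewrite addr_ge0.
move=> a n x x0.
pose M : R -> R := prefix_max (block_modulus a) 1 n.+1.
have mN m1 n1 : measurable_fun setT (block_modulus a m1 n1).
  exact: (@measurable_block_modulus _ _ _ (fun k (_ : R) => a k) id).
have mM : measurable_fun setT M.
  by apply: measurable_bigmax_nat => k; exact: mN.
have mA : measurable (circle R `&` [set t | x < M t]%R).
  apply: measurableI; first exact: measurable_circle.
  exact: measurable_superlevel.
set S := \sum_(1 <= k < n.+1) _.
have S0 : 0 <= S by apply: sumr_ge0 => k _; rewrite le_min ler01 powR_ge0.
have [S1|S1] := leP 1 S.
  apply: (@le_trans _ _ (lebesgue_measure (circle R))).
    by apply: le_measure => //; rewrite inE//; exact: measurable_circle.
  rewrite lebesgue_measure_circle lee_fin [leRHS]mulrDl -[leLHS]add0r.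
  by rewrite lerD ?mulr_ge0// ler_peMr.
have := HK (block_modulus a) (fun k => `|a k| `^ q)
  (block_modulus_ge0 a) mN (block_modulusD a)
  (fun k => powR_ge0 _ _) (fun m1 n1 => block_modulus_L2 a m1 n1 q02) 1%N n.+1.
rewrite -/M => HM.
have SE : \sum_(1 <= k < n.+1) `|a k| `^ q = x `^ q * S.
  rewrite /S mulr_sumr; apply: eq_big_nat => k kn.
  have : Num.min 1 ((`|a k| / x) `^ q) <= S.
    rewrite /S (bigD1_seq k) ?mem_index_iota ?iota_uniq//=.
    by rewrite lerDl sumr_ge0// => i _; rewrite le_min ler01 powR_ge0.
  move=> /le_lt_trans/(_ S1); rewrite gt_min ltxx/= => /ltW qk.
  rewrite (min_r qk).
  rewrite -powRM ?divr_ge0// ?ltW//.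
  by rewrite mulrC divfK// gt_eqF.
have cheb : ((x ^+ 2)%:E * lebesgue_measure (circle R `&` [set t | x < M t]%R) <=
    (K * (x `^ q * S) `^ (2 / q))%R%:E)%E.
  rewrite -SE; apply: le_trans HM.
  have mM2 (D : set R) : measurable_fun D (fun t => (M t ^+ 2)%:E).
    apply/measurable_EFinP; apply: measurable_funX; exact: measurable_funTS.
  rewrite -integral_cst//.
  apply: (@le_trans _ _
    (\int[lebesgue_measure]_(t in circle R `&` [set t | x < M t]%R)
      (M t ^+ 2)%:E)%E).
    apply: ge0_le_integral => //.
    - by move=> t _; rewrite lee_fin sqr_ge0.
    - exact: mM2.
    - by move=> t [_ /= xM]; rewrite lee_fin ler_sqr ?nnegrE ltW// (lt_trans x0).
  apply: ge0_subset_integral => //; do ?[exact: measurable_circle | exact: mM2].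
  by move=> t _; rewrite lee_fin sqr_ge0.
have S2 : S `^ (2 / q) <= S.
  have [->|Sn0] := eqVneq S 0; first by rewrite powR0// gt_eqF//; lra.
  by rewrite ge1r_powR ?(ltW al1)// lt_neqAle eq_sym Sn0 S0 ltW.
move: cheb; rewrite powRM ?powR_ge0// -powRrM [q * _]mulrC divfK ?gt_eqF//.
rewrite powR_mulrn ?(ltW x0)// => cheb.
have x20 : 0 < x ^+ 2 by rewrite exprn_gt0.
have : (lebesgue_measure (circle R `&` [set t | x < M t]%R) <=
    (K * S `^ (2 / q))%R%:E)%E.
  by rewrite -(@lee_pmul2l _ (x ^+ 2)%:E) ?lte_fin// -EFinM mulrCA.
move=> /le_trans; apply; rewrite lee_fin [leRHS]mulrDl -[leLHS]addr0.
by rewrite lerD ?mulr_ge0 ?pi_ge0// ler_wpM2l.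
Qed.

(** * A truncated power series *)

(** The discrete form of [x^{-s-1} = - (x^{-s} / s)'], from [1 + u <= exp u] and
    [ln (n / (n + 1)) <= - 1 / (n + 1)]. *)
Lemma powR_decr_step (R : realType) (s : R) (n : nat) : 0 < s -> (0 < n)%N ->
  n.+1%:R `^ (- s - 1) <= s^-1 * (n%:R `^ (- s) - n.+1%:R `^ (- s)).
Proof.
move=> s0; case: n => [//|n] _.
set x : R := n.+1%:R; set y : R := n.+2%:R.
have x0 : 0 < x by rewrite ltr0n.
have y0 : 0 < y by rewrite ltr0n.
have yx : y = x + 1 by rewrite /y -natr1.
rewrite ler_pdivlMl//.
have -> : y `^ (- s - 1) = y `^ (- s) / y.
  rewrite powRD; last by apply/implyP => _; rewrite gt_eqF.
  by rewrite powR_inv1// ltW.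
have -> : x `^ (- s) = y `^ (- s) * expR (s * (ln y - ln x)).
  rewrite /powR !gt_eqF// -expRD; congr expR; ring.
rewrite -[X in _ - X]mulr1 -mulrBr mulrCA ler_wpM2l ?powR_ge0//.
rewrite lerBrDl (le_trans _ (expR_ge1Dx _))// lerD2l ler_wpM2l ?(ltW s0)//.
have : ln (x / y) <= - y^-1.
  have -> : x / y = 1 + (- y^-1) by rewrite yx; field; rewrite gt_eqF//; lra.
  apply: le_ln1Dx; rewrite ltrN2 invf_lt1// yx; lra.
by rewrite ln_div ?posrE// => h; rewrite -lerN2 opprB.
Qed.

(** The summand is [n^{b-1}] up to [y] and [y^g n^{b-1-g}] beyond, so the sum is of
    order [y^b] in both ranges. The bound proved by induction on [N] is [N^b] while
    [N <= y], and afterwards [(2 + 1/s) y^b - y^g N^{-s} / s] with [s = g - b],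
    the subtracted term telescoping. Of the 2, one unit pays for the terms up to
    [y] and the other for the first term beyond. *)
Lemma sum_powR_min_le (R : realType) (b g y : R) (N : nat) :
  1 <= b -> b < g -> 0 <= y ->
  \sum_(1 <= n < N.+1) n%:R `^ (b - 1) * Num.min 1 ((y / n%:R) `^ g) <=
  (2 + (g - b)^-1) * y `^ b.
Proof.
move=> b1 bg y0; set s := g - b.
have s0 : 0 < s by rewrite subr_gt0.
have gE : g = b + s by rewrite /s; ring.
clearbody s; have sV0 : 0 <= s^-1 by rewrite invr_ge0 ltW.
pose P N := \sum_(1 <= n < N.+1) n%:R `^ (b - 1) * Num.min 1 ((y / n%:R) `^ g).
rewrite -/(P N).
suff : P N <= if N%:R <= y then N%:R `^ b
              else (2 + s^-1) * y `^ b - s^-1 * (y `^ g * N%:R `^ (- s)).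
  move=> /le_trans; apply; case: ifPn => Ny.
    apply: (@le_trans _ _ (y `^ b)).
      by rewrite ge0_ler_powR ?nnegrE//; lra.
    by rewrite ler_peMl ?powR_ge0//; lra.
  by rewrite gerBl// !mulr_ge0 ?powR_ge0.
elim: N => [|N ih].
  by rewrite /P big_geq// y0 powR_ge0.
have -> : P N.+1 = P N + N.+1%:R `^ (b - 1) * Num.min 1 ((y / N.+1%:R) `^ g).
  by rewrite /P big_nat_recr.
set x : R := N.+1%:R.
have x0 : 0 < x by rewrite ltr0n.
have xN : x = N%:R + 1 by rewrite /x -natr1.
have [xy|yx] := leP x y.
  have Ny : N%:R <= y by lra.
  rewrite Ny in ih.
  apply: (@le_trans _ _ (N%:R `^ b + x `^ (b - 1))).
    apply: lerD => //.
    by rewrite ler_piMr ?powR_ge0// ge_min lexx.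
  have -> : x `^ b = (N%:R + 1) * x `^ (b - 1).
    by rewrite -xN mulr_powRB1//; lra.
  rewrite mulrDl mul1r lerD2r -[leLHS]mulr_powRB1//; last lra.
  by rewrite ler_wpM2l// ge0_ler_powR ?nnegrE//; lra.
have term : x `^ (b - 1) * Num.min 1 ((y / x) `^ g) <= y `^ g * x `^ (- s - 1).
  apply: (@le_trans _ _ (x `^ (b - 1) * (y / x) `^ g)).
    by rewrite ler_wpM2l ?powR_ge0// ge_min lexx orbT.
  have xV0 : 0 <= x^-1 by rewrite invr_ge0 ltW.
  rewrite (powRM _ y0 xV0) -(powR_inv1 (ltW x0)) -powRrM mulN1r mulrCA.
  rewrite -powRD; last by apply/implyP => _; rewrite gt_eqF.
  by rewrite (_ : b - 1 - g = - s - 1) // gE; ring.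
have ygE : y `^ g = y `^ b * y `^ s.
  have [->|yn0] := eqVneq y 0; first by rewrite !powR0 ?mul0r// gt_eqF//; lra.
  by rewrite -powRD ?yn0 ?implybT// gE.
have yxs : y `^ g * x `^ (- s) <= y `^ b.
  rewrite ygE -mulrA ler_piMr ?powR_ge0// powRN ler_pdivrMr ?powR_gt0// mul1r.
  by rewrite ge0_ler_powR ?nnegrE//; lra.
(* Either [N + 1] is the first index beyond [y], or [N] is beyond it already. *)
have [Ny|yN] := leP N%:R y.
  rewrite Ny in ih.
  have term2 : y `^ g * x `^ (- s - 1) <= y `^ b.
    apply: le_trans yxs; rewrite ler_wpM2l ?powR_ge0// ler_powR ?/x ?ler1n//.
    lra.
  have NyB : N%:R `^ b <= y `^ b by rewrite ge0_ler_powR ?nnegrE//; lra.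
  have : s^-1 * (y `^ g * x `^ (- s)) <= s^-1 * y `^ b.
    by rewrite ler_wpM2l.
  by rewrite mulrDl; lra.
rewrite (lt_geF yN) in ih.
have N0 : (0 < N)%N by rewrite lt0n; apply: contraTneq yN => ->; rewrite -leNgt.
have dec := powR_decr_step s0 N0.
have : y `^ g * x `^ (- s - 1) <=
       y `^ g * (s^-1 * (N%:R `^ (- s) - x `^ (- s))).
  by rewrite ler_wpM2l ?powR_ge0.
rewrite [X in _ <= X -> _]mulrCA mulrBr mulrBr.
lra.
Qed.

(** * Tonelli for sections and stochastic domination *)

Lemma setE_xsection T1 T2 (A : set (T1 * T2)) (x : T1) :
  [set y | A (x, y)] = xsection A x.
Proof. by apply/seteqP; split => y; rewrite /xsection/= inE. Qed.

Lemma setE_ysection T1 T2 (A : set (T1 * T2)) (y : T2) :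
  [set x | A (x, y)] = ysection A y.
Proof. by apply/seteqP; split => x; rewrite /ysection/= inE. Qed.

Lemma measurable_measure_section (R : realType) d1 d2 (T1 : measurableType d1)
    (T2 : measurableType d2) (m2 : {sigma_finite_measure set T2 -> \bar R})
    (A : set (T1 * T2)) :
  measurable A -> measurable_fun setT (fun x => m2 [set y | A (x, y)]).
Proof.
by move=> mA; under eq_fun do rewrite setE_xsection; exact: measurable_fun_xsection.
Qed.

Lemma integral_measure_sections (R : realType) d1 d2 (T1 : measurableType d1)
    (T2 : measurableType d2) (m1 : {sigma_finite_measure set T1 -> \bar R})
    (m2 : {sigma_finite_measure set T2 -> \bar R}) (A : set (T1 * T2)) :
  measurable A ->
  (\int[m1]_x m2 [set y | A (x, y)] = \int[m2]_y m1 [set x | A (x, y)])%E.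
Proof.
move=> mA.
have mx x : measurable [set y | A (x, y)].
  by rewrite setE_xsection; exact: measurable_xsection.
have my y : measurable [set x | A (x, y)].
  by rewrite setE_ysection; exact: measurable_ysection.
transitivity (\int[m1]_x \int[m2]_y (\1_A (x, y))%:E)%E.
  apply: eq_integral => x _.
  by rewrite -[X in m2 X]setIT -integral_indic//; exact: mx.
rewrite (fubini_tonelli (fun z => (\1_A z)%:E))//; last first.
  by apply/measurable_EFinP; exact: measurable_indic.
apply: eq_integral => y _.
by rewrite -[X in m1 X]setIT -integral_indic//; exact: my.
Qed.

Lemma measurable_hypograph (R : realType) d (T : measurableType d)
    (Y : T -> R) : measurable_fun setT Y ->
  measurable [set z : measurableTypeR R * T | z.1 <= Y z.2].
Proof.
move=> mY; rewrite -[X in measurable X]setTI.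
have mD : measurable_fun setT (fun z : measurableTypeR R * T => Y z.2 - z.1).
  apply: measurable_funB; first exact: measurableT_comp.
  exact: measurable_fst.
have -> : [set z | (z.1 <= Y z.2)%R] =
    (fun z : measurableTypeR R * T => Y z.2 - z.1) @^-1` `[0, +oo[.
  by apply/seteqP; split => z /=; rewrite in_itv/= andbT subr_ge0.
exact: mD.
Qed.

(** Layer cake formula for [min (1, Y)], stated with the events [s <= Y] because
    the domination hypothesis is about non-strict inequalities. *)
Lemma expectation_min1 (R : realType) d (T : measurableType d)
    (P : probability T R) (Y : T -> R) :
  measurable_fun setT Y -> (forall w, 0 <= Y w) ->
  (\int[P]_w (Num.min 1 (Y w))%:E =
   \int[lebesgue_measure]_(s in `[0%R, 1%R]) P [set w | s <= Y w]%R)%E.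
Proof.
move=> mY Y0.
pose A : set (measurableTypeR R * T) := [set z | z.1 \in `[0, 1] /\ z.1 <= Y z.2].
have mA : measurable A.
  apply: measurableI; last exact: measurable_hypograph.
  rewrite -[X in measurable X]setTI.
  exact: (@measurable_fst _ _ (measurableTypeR R) T measurableT _ (measurable_itv _)).
have E := integral_measure_sections (@lebesgue_measure R) P mA.
transitivity (\int[P]_y lebesgue_measure [set x | A (x, y)])%E.
  apply: eq_integral => w _.
  have -> : [set x | A (x, w)] = `[0, Num.min 1 (Y w)]%classic.
    apply/seteqP; split => x; rewrite /A/= !in_itv/= le_min.
      by case=> /andP[-> ->] ->.
    by move=> /and3P[-> -> ->].
  rewrite lebesgue_measure_itv/= lte_fin; case: ltP => m0.
    by rewrite EFinN sube0.
  by congr EFin; apply/eqP; rewrite eq_le m0 le_min ler01 Y0.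
rewrite -E [RHS]integral_mkcond; apply: eq_integral => s _.
rewrite patchE mem_setE.
have [s01|s01] := boolP (s \in `[0, 1]).
  by congr (P _); apply/seteqP; split => w //= [].
rewrite -[RHS](measure0 P); congr (P _); apply/seteqP; split => w //= [].
by rewrite (negbTE s01).
Qed.

(** By the layer cake formula both sides are integrals over [s] in [[0, 1]] of the
    probabilities that [|U|], respectively [|V|], is at least [x * s^{1/q}]. *)
Lemma stochastic_domination_min (R : realType) d (T : measurableType d)
    (P : probability T R) (U V : T -> R) (q x : R) :
  measurable_fun setT U -> measurable_fun setT V -> 0 < q -> 0 < x ->
  (forall s : R, 0 <= s ->
    (P [set w | (s <= `|U w|)%R] <= P [set w | (s <= `|V w|)%R])%E) ->
  (\int[P]_w (Num.min 1 ((`|U w| / x) `^ q))%:E <=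
   \int[P]_w (Num.min 1 ((`|V w| / x) `^ q))%:E)%E.
Proof.
move=> mU mV q0 x0 UV.
have mY (Z : T -> R) : measurable_fun setT Z ->
    measurable_fun setT (fun w => (`|Z w| / x) `^ q).
  move=> mZ; apply: (measurableT_comp (@measurable_powR R q)).
  by apply: measurable_funM => //; apply: measurableT_comp.
have level (Z : T -> R) (s : R) : s \in `[0, 1] ->
    [set w | s <= (`|Z w| / x) `^ q] = [set w | x * s `^ q^-1 <= `|Z w|].
  rewrite in_itv/= => /andP[s0 _].
  have sE : s = (s `^ q^-1) `^ q by rewrite -powRrM mulVf ?gt_eqF// powRr1.
  apply/seteqP; split => w /=; rewrite [x * _]mulrC -ler_pdivlMr//.
    rewrite [leLHS]sE leNgt => h; rewrite leNgt; apply: contra h => h.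
    by rewrite gt0_ltr_powR ?nnegrE ?powR_ge0 ?divr_ge0 ?(ltW x0).
  by move=> h; rewrite [leLHS]sE ge0_ler_powR ?nnegrE ?powR_ge0 ?divr_ge0
    ?(ltW x0) ?(ltW q0).
have Y0 (Z : T -> R) w : 0 <= (`|Z w| / x) `^ q by exact: powR_ge0.
rewrite (expectation_min1 P (mY U mU) (Y0 U)).
rewrite (expectation_min1 P (mY V mV) (Y0 V)).
have mP (Z : T -> R) : measurable_fun setT Z ->
    measurable_fun (`[0, 1]%classic : set (measurableTypeR R)) (fun s =>
      P [set w | s <= (`|Z w| / x) `^ q]%R).
  move=> mZ; apply: measurable_funTS.
  exact: (measurable_measure_section P (measurable_hypograph (mY Z mZ))).
apply: ge0_le_integral => //; do ?[exact: mP|exact: measurable_itv].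
move=> s s01; rewrite !level//; apply: UV.
by rewrite mulr_ge0 ?powR_ge0// ltW.
Qed.

(** * Integrability of the weighted tail series *)

Lemma measurable_max_block (R : realType) d (T : measurableType d)
    (X : nat -> T -> R) (n : nat) :
  (forall k, measurable_fun setT (X k)) ->
  measurable_fun setT (fun z : measurableTypeR R * T =>
    prefix_max (block_modulus (X ^~ z.2)) 1 n.+1 z.1).
Proof.
move=> mX.
apply: (@measurable_bigmax_nat _ _ (measurableTypeR R * T)%type (fun k z =>
  block_modulus (X ^~ z.2) 1 k.+1 z.1)) => k.
apply: (@measurable_block_modulus _ _ (measurableTypeR R * T)%type
  (fun k z => X k z.2) fst); last exact: measurable_fst.
by move=> j; exact: measurableT_comp.
Qed.

Lemma measurable_max_block_prob (R : realType) d (T : measurableType d)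
    (P : probability T R) (X : nat -> T -> R) (n : nat) (x : R) :
  (forall k, measurable_fun setT (X k)) ->
  measurable_fun setT (fun t : measurableTypeR R =>
    P [set w | (x < prefix_max (block_modulus (X ^~ w)) 1 n.+1 t)%R]).
Proof.
move=> mX; pose A := [set z : measurableTypeR R * T |
  x < prefix_max (block_modulus (X ^~ z.2)) 1 n.+1 z.1].
have mA : measurable A.
  by apply: measurable_superlevel; exact: measurable_max_block.
exact: (measurable_measure_section P mA).
Qed.

(** Tonelli turns the left-hand side into the expectation of the measure of the set
    of [t] where the maximum exceeds [x]; the weak type inequality applies at each
    sample point, with a constant that does not depend on it, and domination
    replaces every [|X k|] by [|X 1|]. *)
Lemma integral_max_block_prob_le (R : realType) (q : R) : 0 < q < 2 ->
  exists2 C : R, 0 <= C & forall d (T : measurableType d) (P : probability T R)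
    (X : nat -> T -> R) (n : nat) (x : R),
    (forall k, measurable_fun setT (X k)) ->
    (forall (k : nat) (s : R), (1 <= k)%N -> 0 <= s ->
      (P [set w | (s <= `|X k w|)%R] <= P [set w | (s <= `|X 1%N w|)%R])%E) ->
    0 < x ->
    (\int[lebesgue_measure]_(t in circle R)
       P [set w | (x < prefix_max (block_modulus (X ^~ w)) 1 n.+1 t)%R] <=
     (C * n%:R)%:E * \int[P]_w (Num.min 1 ((`|X 1%N w| / x) `^ q))%R%:E)%E.
Proof.
move=> q02; have [C C0 HC] := max_block_weak_type q02.
exists C => // d T P X n x mX Xdom x0.
have [q0 _] := andP q02.
pose A := [set z : measurableTypeR R * T |
  circle R z.1 /\ x < prefix_max (block_modulus (X ^~ z.2)) 1 n.+1 z.1].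
have mA : measurable A.
  apply: measurableI; last first.
    by apply: measurable_superlevel; exact: measurable_max_block.
  rewrite -[X in measurable X]setTI.
  exact: (@measurable_fst _ _ (measurableTypeR R) T measurableT _
    (@measurable_circle R)).
have mmin k : measurable_fun setT (fun w => Num.min 1 ((`|X k w| / x) `^ q)).
  apply: measurable_minr => //.
  apply: (measurableT_comp (@measurable_powR R q)).
  by apply: measurable_funM => //; apply: measurableT_comp.
have min0 k w : 0 <= Num.min 1 ((`|X k w| / x) `^ q).
  by rewrite le_min ler01 powR_ge0.
have -> : (\int[lebesgue_measure]_(t in circle R)
       P [set w | (x < prefix_max (block_modulus (X ^~ w)) 1 n.+1 t)%R] =
    \int[lebesgue_measure]_t P [set w | A (t, w)])%E.
  rewrite integral_mkcond; apply: eq_integral => t _.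
  rewrite patchE; case: ifPn => [/set_mem ct|/negP ct].
    by congr (P _); apply/seteqP; split => w //= [].
  rewrite -[LHS](measure0 P); congr (P _); apply/seteqP; split => w //= [].
  by move=> /mem_set/ct.
rewrite (integral_measure_sections (@lebesgue_measure R) P mA).
apply: (@le_trans _ _ (\int[P]_w (C%:E *
    \sum_(1 <= k < n.+1) (Num.min 1 ((`|X k w| / x) `^ q))%R%:E))%E).
  apply: ge0_le_integral => //.
  - under eq_fun do rewrite setE_ysection.
    exact: (measurable_fun_ysection (@lebesgue_measure R)).
  - apply: measurable_funeM; apply: emeasurable_sum => k.
    exact/measurable_EFinP.
  - move=> w _; rewrite sumEFin -EFinM; apply: le_trans (HC (X ^~ w) n x x0).
    exact: lexx.
rewrite ge0_integralZl_EFin//; last 2 first.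
- by move=> w _; apply: sume_ge0 => k _; rewrite lee_fin.
- by apply: emeasurable_sum => k; exact/measurable_EFinP.
rewrite ge0_integral_sum//; last 2 first.
- by move=> k; exact/measurable_EFinP.
- by move=> k w _; rewrite lee_fin.
rewrite EFinM -muleA lee_wpmul2l ?lee_fin//.
apply: (@le_trans _ _ (\sum_(1 <= k < n.+1)
   \int[P]_w (Num.min 1 ((`|X 1%N w| / x) `^ q))%R%:E)%E).
  rewrite [leLHS]big_nat [leRHS]big_nat; apply: lee_sum => k /andP[k1 _].
  by apply: stochastic_domination_min => // s; exact: Xdom.
rewrite big_const_nat subn1/=.
set I := (\int[P]_w _)%E.
have I0 : (0 <= I)%E by apply: integral_ge0 => w _; rewrite lee_fin.
elim: (n) => [|m ih]; first by rewrite mul0e.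
by rewrite iterS -natr1 EFinD ge0_muleDl ?lee_fin// mul1e addeC leeD.
Qed.

Lemma nneseries_le_bound (R : realType) (f : nat -> \bar R) (m : nat) (c : \bar R) :
  (forall n, 0 <= f n)%E ->
  (forall n, \sum_(m <= k < n) f k <= c)%E -> (\sum_(m <= k <oo) f k <= c)%E.
Proof.
move=> f0 fc; apply: lime_le; last by apply: nearW => n; exact: fc.
by apply: is_cvg_nneseries => n _ _.
Qed.

Lemma integral_nneseries_from (R : realType) d (T : measurableType d)
    (mu : {measure set T -> \bar R}) (D : set T) (f : nat -> T -> \bar R) (m : nat) :
  measurable D -> (forall n, measurable_fun D (f n)) ->
  (forall n x, D x -> 0 <= f n x)%E ->
  (\int[mu]_(x in D) (\sum_(m <= n <oo) f n x) =
   \sum_(m <= n <oo) \int[mu]_(x in D) f n x)%E.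
Proof.
move=> mD mf f0.
have E (u : nat -> \bar R) : (\sum_(m <= n <oo) u n =
    \sum_(n <oo) if (m <= n)%N then u n else 0)%E.
  apply/congr_lim/funext => n.
  by rewrite (big_nat_widenl _ 0%N)// big_mkcond.
pose g n x := if (m <= n)%N then f n x else 0%E.
transitivity (\int[mu]_(x in D) (\sum_(n <oo) g n x))%E.
  apply: eq_integral => x _.
  exact: E.
rewrite integral_nneseries//; last 2 first.
- by move=> n; rewrite /g; case: (m <= n)%N.
- by move=> n x Dx; rewrite /g; case: ifP => // _; exact: f0.
rewrite E; apply: eq_eseriesr => n _.
by rewrite /g; case: (m <= n)%N => //; rewrite integral0.
Qed.

Lemma ae_lty_of_integral_lty (R : realType) d (T : measurableType d)
    (mu : {measure set T -> \bar R}) (D : set T) (f : T -> \bar R) :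
  measurable D -> measurable_fun D f -> (forall x, D x -> 0 <= f x)%E ->
  (\int[mu]_(x in D) f x < +oo)%E -> {ae mu, forall x, D x -> (f x < +oo)%E}.
Proof.
move=> mD mf f0 foo.
have /integrable_ae : mu.-integrable D f.
  apply/integrableP; split => //; rewrite (eq_integral f)// => x /[!inE] Dx.
  by rewrite gee0_abs// f0.
move=> /(_ mD); apply: filterS => x /[apply].
by rewrite fin_numE => /andP[_]; rewrite ltey.
Qed.

(** Rewrites the truncated ratio in the variable [y = (u / eps)^r], in which it has
    the form required by [sum_powR_min_le] with [g = q / r]. *)
Lemma min_ratio_powR (R : realType) (p q r eps u : R) (n : nat) :
  (0 < n)%N -> 0 <= u -> 0 < eps -> 0 < r ->
  (u / (eps * n%:R `^ r^-1)) `^ q = ((u / eps) `^ r / n%:R) `^ (q / r).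
Proof.
move=> n0 u0 e0 r0.
have v0 : 0 <= u / eps by rewrite divr_ge0// ltW.
have -> : u / (eps * n%:R `^ r^-1) = u / eps * n%:R `^ (- r^-1).
  by rewrite invfM mulrA powRN.
move: (u / eps) v0 => v v0.
rewrite (powRM _ v0 (powR_ge0 _ _)) -powRrM.
rewrite -(powR_inv1 (ler0n R n)) (powRM _ (powR_ge0 _ _) (powR_ge0 _ _)) -!powRrM.
have -> : r * (q / r) = q by rewrite mulrC divfK// gt_eqF.
by congr (_ * _ `^ _); ring.
Qed.

(** The [n]-th term of the series of (ii): [max_trig_sum X n t w] unfolds to the
    maximum written here. *)
Definition tail_term (R : realType) d (T : measurableType d)
    (P : probability T R) (X : nat -> T -> R) (p r eps : R)
    (n : nat) (t : R) : \bar R :=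
  ((n%:R `^ (p / r - 2))%:E * P [set w |
    (eps * n%:R `^ r^-1 < prefix_max (block_modulus (X ^~ w)) 1 n.+1 t)%R])%E.

Lemma tail_term_ge0 (R : realType) d (T : measurableType d)
    (P : probability T R) (X : nat -> T -> R) (p r eps : R)
    (n : nat) (t : R) : (0 <= tail_term P X p r eps n t)%E.
Proof. by rewrite mule_ge0 ?lee_fin ?powR_ge0. Qed.

Lemma measurable_tail_term (R : realType) d (T : measurableType d)
    (P : probability T R) (X : nat -> T -> R) (p r eps : R)
    (n : nat) (D : set (measurableTypeR R)) :
  (forall k, measurable_fun setT (X k)) ->
  measurable_fun D (tail_term P X p r eps n).
Proof.
move=> mX; apply: measurable_funeM; apply: measurable_funTS.
exact: measurable_max_block_prob.
Qed.

(** The integral over the circle of the sum of the series is finite. Take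
    [q = (p + 2) / 2]; after [integral_max_block_prob_le] the factor [n^{p/r-2} n]
    is [n^{b-1}] with [b = p / r >= 1], and [sum_powR_min_le] bounds
    the sum under the expectation by a constant times
    [((|X 1| / eps)^r)^b = (|X 1| / eps)^p]. *)
Lemma ae_tail_series_lty (R : realType) d (T : measurableType d)
    (P : probability T R) (X : nat -> T -> R) (p r eps : R) :
  (forall k, measurable_fun setT (X k)) ->
  (forall (k : nat) (s : R), (1 <= k)%N -> 0 <= s ->
    (P [set w | (s <= `|X k w|)%R] <= P [set w | (s <= `|X 1%N w|)%R])%E) ->
  1 <= p < 2 -> 1 <= r <= p ->
  (\int[P]_w (`|X 1%N w| `^ p)%:E < +oo)%E -> 0 < eps ->
  {ae lebesgue_measure, forall t : R, circle R t ->
    (\sum_(1 <= n <oo) tail_term P X p r eps n t < +oo)%E}.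
Proof.
move=> mX Xdom p12 r1p Xp eps0.
have mC := @measurable_circle R.
apply: ae_lty_of_integral_lty => //.
- under eq_fun do rewrite eseries_cond.
  apply: ge0_emeasurable_sum => //.
  + by move=> n t _ _; exact: tail_term_ge0.
  + by move=> n _; exact: measurable_tail_term.
- by move=> t _; apply: nneseries_ge0 => n _ _; exact: tail_term_ge0.
rewrite integral_nneseries_from//; last 2 first.
- by move=> n; exact: measurable_tail_term.
- by move=> n t _; exact: tail_term_ge0.
have [p1 p2] := andP p12; have [r1 rp] := andP r1p.
have r0 : 0 < r by lra.
pose q := (p + 2) / 2.
have pq : p < q by rewrite /q; lra.
have q02 : 0 < q < 2 by rewrite /q; apply/andP; split; lra.
have [C C0 HC] := integral_max_block_prob_le q02.
pose b := p / r.
have b1 : 1 <= b by rewrite ler_pdivlMr// mul1r.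
have bg : b < q / r by rewrite ltr_pM2r// invr_gt0.
pose K := (2 + (q / r - b)^-1).
have K0 : 0 <= K by rewrite addr_ge0// invr_ge0 subr_ge0 ltW.
pose y w := (`|X 1%N w| / eps) `^ r.
have my : measurable_fun setT y.
  apply: (measurableT_comp (@measurable_powR R r)).
  by apply: measurable_funM => //; apply: measurableT_comp.
pose h n w := n%:R `^ (b - 1) * Num.min 1 ((y w / n%:R) `^ (q / r)).
have h0 n w : 0 <= h n w.
  by rewrite mulr_ge0 ?powR_ge0// le_min ler01 powR_ge0.
have mh n : measurable_fun setT (h n).
  apply: measurable_funM => //; apply: measurable_minr => //.
  apply: (measurableT_comp (@measurable_powR R (q / r))).
  exact: measurable_funM.
have term_le n : (0 < n)%N ->
  (\int[lebesgue_measure]_(t in circle R) tail_term P X p r eps n t <=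
    C%:E * \int[P]_w (h n w)%:E)%E.
  move=> n0; have n0R : 0 < n%:R :> R by rewrite ltr0n.
  rewrite ge0_integralZl_EFin ?powR_ge0//; last first.
    by apply: measurable_funTS; exact: measurable_max_block_prob.
  have x0 : 0 < eps * n%:R `^ r^-1 by rewrite mulr_gt0// powR_gt0.
  apply: (@le_trans _ _ ((n%:R `^ (p / r - 2))%:E * ((C * n%:R)%:E *
      \int[P]_w (Num.min 1 ((`|X 1%N w| / (eps * n%:R `^ r^-1)) `^ q))%R%:E))%E).
    by rewrite lee_wpmul2l ?lee_fin ?powR_ge0// HC.
  rewrite muleA -EFinM (_ : n%:R `^ _ * (C * _) = C * n%:R `^ (b - 1)); last first.
    rewrite mulrCA; congr (_ * _).
    rewrite -[X in _ * X]powRr1// -powRD; last by apply/implyP => _; rewrite gt_eqF.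
    by congr (_ `^ _); rewrite /b; ring.
  rewrite EFinM -muleA; apply: lee_wpmul2l; first by rewrite lee_fin.
  pose g w := Num.min 1 ((`|X 1%N w| / (eps * n%:R `^ r^-1)) `^ q).
  have mg : measurable_fun setT g.
    apply: measurable_minr => //; apply: (measurableT_comp (@measurable_powR R q)).
    by apply: measurable_funM => //; apply: measurableT_comp.
  have g0 w : 0 <= g w by rewrite le_min ler01 powR_ge0.
  rewrite le_eqVlt; apply/orP; left; apply/eqP.
  transitivity (\int[P]_w ((n%:R `^ (b - 1))%:E * (g w)%:E))%E.
    rewrite ge0_integralZl_EFin ?powR_ge0//; first by move=> w _; rewrite lee_fin.
    exact/measurable_EFinP.
  apply: eq_integral => w _.
  by rewrite -EFinM /h /y /g min_ratio_powR.
apply: (@le_lt_trans _ _ (C%:E * ((K * (eps^-1) `^ p)%:E *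
    \int[P]_w (`|X 1%N w| `^ p)%:E))%E); last first.
  by rewrite !lte_mul_pinfty ?lee_fin ?mulr_ge0 ?powR_ge0.
apply: nneseries_le_bound => [n|N].
  by apply: integral_ge0 => t _; exact: tail_term_ge0.
apply: (@le_trans _ _ (\sum_(1 <= n < N) C%:E * \int[P]_w (h n w)%:E)%E).
  by rewrite [leLHS]big_nat [leRHS]big_nat; apply: lee_sum => n /andP[n1 _]; exact: term_le.
rewrite -ge0_sume_distrr; last first.
  by move=> n _; apply: integral_ge0 => w _; rewrite lee_fin.
rewrite lee_wpmul2l ?lee_fin// -ge0_integral_sum//; last 2 first.
- by move=> n; exact/measurable_EFinP.
- by move=> n w _; rewrite lee_fin.
rewrite -ge0_integralZl_EFin ?mulr_ge0 ?powR_ge0//; last first.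
  apply/measurable_EFinP; apply: (measurableT_comp (@measurable_powR R p)).
  exact: measurableT_comp.
apply: ge0_le_integral => //.
- by move=> w _; apply: sume_ge0 => n _; rewrite lee_fin.
- by apply: emeasurable_sum => n; exact/measurable_EFinP.
- apply: measurable_funeM; apply/measurable_EFinP.
  by apply: (measurableT_comp (@measurable_powR R p)); exact: measurableT_comp.
move=> w _; rewrite sumEFin -EFinM lee_fin.
have y0 : 0 <= y w by exact: powR_ge0.
have -> : K * eps^-1 `^ p * `|X 1%N w| `^ p = K * y w `^ b.
  rewrite -mulrA -powRM ?invr_ge0 ?(ltW eps0)// [eps^-1 * _]mulrC /y -powRrM.
  by rewrite /b [r * _]mulrC divfK ?gt_eqF.
case: N => [|N]; first by rewrite big_geq// mulr_ge0 ?powR_ge0.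
exact: sum_powR_min_le.
Qed.

(** * Almost sure convergence *)

(** Were [M n > 2 eps n^{1/p}] for a large [n], then for [n <= k < 2 n] also
    [M k >= M n > 2 eps n^{1/p} >= eps (2 n)^{1/p} >= eps k^{1/p}]; these [n] terms
    are each at least [1 / (2 n)], so that the tail of the series would be at
    least [1/2]. *)
Lemma series_inv_lty_growth (R : realType) (M : nat -> R) (p eps : R) :
  1 <= p -> 0 < eps -> {homo M : m n / (m <= n)%N >-> m <= n} ->
  (\sum_(1 <= n <oo)
     ((n%:R^-1 : R) * (eps * n%:R `^ p^-1 < M n)%R%:R)%R%:E < +oo)%E ->
  \forall n \near \oo, M n <= 2 * eps * n%:R `^ p^-1.
Proof.
move=> p1 e0 Mnd.
pose f (n : nat) : \bar R :=
  ((n%:R^-1 : R) * (eps * n%:R `^ p^-1 < M n)%R%:R)%R%:E.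
rewrite -/(f _) => foo.
have f0 n : (0 <= f n)%E by rewrite lee_fin mulr_ge0.
have f00 : f 0%N = 0%E by rewrite /f invr0 mul0r.
have foo' : (\sum_(0 <= n <oo) f n < +oo)%E.
  by rewrite nneseries_recl// f00 add0e.
have /fine_cvgP[tail_fin] := nneseries_tail_cvg foo' (fun k _ => f0 k).
have half : 0 < 2^-1 :> R by rewrite invr_gt0.
move=> /cvgr0Pnorm_lt/(_ _ half) tail_small.
near=> n; rewrite leNgt; apply/negP => Mn.
have n0 : (0 < n)%N by near: n; exists 1%N.
have n0R : 0 < n%:R :> R by rewrite ltr0n.
have fk k : (n <= k < n + n)%N -> ((2 * n%:R)^-1%:E <= f k)%E.
  move=> /andP[nk kn]; have k0 : (0 < k)%N by exact: leq_trans nk.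
  have kn2 : k%:R <= 2 * n%:R :> R.
    by rewrite -natrM mul2n -addnn ler_nat ltnW.
  rewrite lee_fin (_ : _ < M k) ?mulr1.
    by rewrite lef_pV2// posrE ?mulr_gt0 ?ltr0n.
  apply: lt_le_trans (Mnd _ _ nk); apply: le_lt_trans Mn.
  rewrite [2 * _]mulrC -mulrA ler_pM2l//.
  apply: (@le_trans _ _ ((2 * n%:R) `^ p^-1)).
    by rewrite ge0_ler_powR ?nnegrE ?invr_ge0 ?mulr_ge0//; lra.
  rewrite powRM// ler_wpM2r ?powR_ge0// ler1_powR ?ler1n//.
  by rewrite invf_le1//; lra.
have : fine (\sum_(n <= k <oo) f k)%E < 2^-1.
  apply: le_lt_trans (ler_norm _) _.
  by near: n.
apply/negP; rewrite -leNgt -lee_fin fineK; last by near: n.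
rewrite (nneseries_split n n)//.
apply: (@le_trans _ _ (\sum_(n <= k < n + n) f k)%E); last first.
  by rewrite leeDl// nneseries_ge0.
apply: (@le_trans _ _ (\sum_(n <= k < n + n) (2 * n%:R)^-1%:E)%E); last first.
  by rewrite !big_nat; apply: lee_sum.
rewrite sumEFin lee_fin sumr_const_nat addnK -[leRHS]mulr_natr.
by rewrite [leRHS](_ : _ = 2^-1)//; field; rewrite gt_eqF.
Unshelve. all: by end_near. Qed.

Lemma indic_bool (R : realType) (T : Type) (b : pred T) (x : T) :
  \1_[set y | b y] x = (b x)%:R :> R.
Proof.
by rewrite indicE; congr ((nat_of_bool _)%:R); apply/idP/idP => [/set_mem|/mem_set].
Qed.

(** With [r = p] the weight in the series of (ii) is [1 / n]. For each of the
    countably many levels [e m], the series is the expectation of the random series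
    in [series_inv_lty_growth], which is therefore finite almost surely. *)
Lemma ae_trig_sum_cvg0 (R : realType) d (T : measurableType d)
    (P : probability T R) (X : nat -> T -> R) (p : R) :
  (forall k, measurable_fun setT (X k)) ->
  (forall (k : nat) (s : R), (1 <= k)%N -> 0 <= s ->
    (P [set w | (s <= `|X k w|)%R] <= P [set w | (s <= `|X 1%N w|)%R])%E) ->
  1 <= p < 2 ->
  (\int[P]_w (`|X 1%N w| `^ p)%:E < +oo)%E ->
  {ae lebesgue_measure, forall t : R, circle R t ->
    {ae P, forall w,
      trig_sum X n t w / (n%:R `^ p^-1)%:C @[n --> \oo] --> (0 : R[i]^o)}}.
Proof.
move=> mX Xdom p12 Xp; have [p1 p2] := andP p12.
have pp : 1 <= p <= p by rewrite p1 lexx.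
pose e (m : nat) : R := m.+1%:R^-1.
have e0 m : 0 < e m by rewrite invr_gt0 ltr0n.
have /ae_foralln := fun m => ae_tail_series_lty mX Xdom p12 pp Xp (e0 m).
apply: filterS => t Ht ct.
have {}Ht m := Ht m ct.
pose M n w := prefix_max (block_modulus (X ^~ w)) 1 n.+1 t.
have mM n : measurable_fun setT (M n).
  apply: measurable_bigmax_nat => k.
  exact: (@measurable_block_modulus _ _ _ X (fun=> t)).
pose g m n w : \bar R :=
  ((n%:R^-1 : R) * (e m * n%:R `^ p^-1 < M n w)%R%:R)%R%:E.
have g0 m n w : (0 <= g m n w)%E by rewrite lee_fin mulr_ge0.
have mg m n : measurable_fun setT (g m n).
  apply/measurable_EFinP; apply: measurable_funM => //.
  have -> : (fun w => (e m * n%:R `^ p^-1 < M n w)%R%:R) =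
      \1_[set w | e m * n%:R `^ p^-1 < M n w] :> (T -> R).
    by apply/funext => w; rewrite indic_bool.
  by apply: measurable_indic; exact: measurable_superlevel.
have intg m n : (0 < n)%N ->
    (\int[P]_w g m n w = tail_term P X p p (e m) n t)%E.
  move=> n0; have n0R : 0 < n%:R :> R by rewrite ltr0n.
  have -> : (fun w => g m n w) = (fun w => (n%:R^-1)%:E *
      (\1_[set w | e m * n%:R `^ p^-1 < M n w] w)%:E)%E.
    apply/funext => w; rewrite /g EFinM; congr (_ * _%:E)%E.
    by rewrite indic_bool.
  have mS : measurable [set w | e m * n%:R `^ p^-1 < M n w].
    exact: measurable_superlevel.
  rewrite ge0_integralZl_EFin ?invr_ge0 ?integral_indic ?setIT//; last first.
    by apply/measurable_EFinP; exact: measurable_indic.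
  rewrite /tail_term divff ?gt_eqF//; last lra.
  congr (_%:E * _)%E.
  by rewrite -powR_inv1//; congr (_ `^ _); ring.
have : {ae P, forall w, forall m, (\sum_(1 <= n <oo) g m n w < +oo)%E}.
  apply: ae_foralln => m.
  have : {ae P, forall w, setT w -> (\sum_(1 <= n <oo) g m n w < +oo)%E}.
    apply: ae_lty_of_integral_lty => //.
    - under eq_fun do rewrite eseries_cond.
      by apply: ge0_emeasurable_sum => //.
    - by move=> w _; apply: nneseries_ge0.
    rewrite integral_nneseries_from//.
    rewrite (_ : limn _ = (\sum_(1 <= n <oo) tail_term P X p p (e m) n t)%E)//.
    apply/congr_lim/funext => N; apply: eq_big_nat => n /andP[n0 _].
    exact: intg.
  by apply: filterS => w /(_ I).
apply: filterS => w Hw.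
have Mnd : {homo M ^~ w : m n / (m <= n)%N >-> m <= n}.
  move=> m n mn; apply: bigmax_nat_le => [|k /andP[k1 kn]].
    exact: bigmax_nat_ge0.
  apply: (@bigmax_nat_sup _ (fun k => block_modulus (X ^~ w) 1 k.+1 t)).
  by rewrite k1 (leq_trans kn).
have growth m := series_inv_lty_growth p1 (e0 m) Mnd (Hw m).
apply/cvgr0Pnorm_lt => -[E Ei] E0.
have [Er0 Ei0] : 0 < E /\ Ei = 0.
  by move: E0; rewrite ltcE/= => /andP[/eqP -> ->].
rewrite Ei0 in E0 *.
have [m mE] : exists m, 2 * e m < E.
  exists (Num.truncn (2 / E)); rewrite /e ltr_pdivrMr ?ltr0n//.
  by rewrite mulrC -ltr_pdivrMr// truncnS_gt.
near=> n.
have n0 : (0 < n)%N by near: n; exists 1%N.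
have c0 : 0 < n%:R `^ p^-1 :> R by rewrite powR_gt0// ltr0n.
have MnE : M n w <= 2 * e m * n%:R `^ p^-1 by near: n; exact: growth.
have SM : Normc.normc (trig_sum X n t w) <= M n w.
  apply: (@bigmax_nat_sup _ (fun k => block_modulus (X ^~ w) 1 k.+1 t)).
  by rewrite n0 ltnSn.
have -> : `|trig_sum X n t w / (n%:R `^ p^-1)%:C| =
    (Normc.normc (trig_sum X n t w) / n%:R `^ p^-1)%:C.
  rewrite normrM normfV -[X in _ / X]/((Normc.normc _)%:C).
  rewrite -fmorphV -rmorphM /= expr0n addr0 sqrtr_sqr ger0_norm ?powR_ge0//.
rewrite ltcR ltr_pdivrMr//.
apply: (le_lt_trans (le_trans SM MnE)).
by rewrite ltr_pM2r.
Unshelve. all: by end_near. Qed.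

(** * Laws of large numbers for random trigonometric sums *)

Lemma ae_circle_sub (R : realType) (Q Q' : R -> Prop) :
  (forall t, Q t -> Q' t) ->
  {ae lebesgue_measure, forall t : R, circle R t -> Q t} ->
  {ae lebesgue_measure, forall t : R, t \in `[- pi, pi[ -> Q' t}.
Proof.
move=> QQ'; apply: filterS.
  exact: (ae_filter_ringOfSetsType (@lebesgue_measure R)).
move=> t Qt tpi; apply/QQ'/Qt; move: tpi.
by rewrite /circle/= !in_itv/= => /andP[-> /ltW ->].
Qed.

Theorem mainTheorem4 (R : realType) (d : measure_display) (T : measurableType d)
    (P : probability T R) (X : nat -> {RV P >-> R})
    (Xdom : forall (n : nat) (x : R), (1 <= n)%N -> 0 <= x ->
      (P [set w | (x <= `|X n w|)%R] <= P [set w | (x <= `|X 1%N w|)%R])%E) :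
  (* (i) *)
  (('E_P[fun w => (`|X 1%N w|)%R] < +oo)%E ->
    {ae lebesgue_measure, forall t : R, t \in `[- pi, pi[ ->
      {ae P, forall w, trig_sum X n t w / n%:R @[n --> \oo] --> (0 : R[i]^o)}})
  /\
  (* (ii) *)
  (forall p r : R, 1 < p < 2 -> 1 <= r <= p ->
    ('E_P[fun w => (`|X 1%N w| `^ p)%R] < +oo)%E ->
    forall eps : R, 0 < eps ->
    {ae lebesgue_measure, forall t : R, t \in `[- pi, pi[ ->
      (\sum_(1 <= n <oo) (((n%:R `^ (p / r - 2))%R)%:E *
          P [set w | (eps * n%:R `^ r^-1 < max_trig_sum X n t w)%R]) < +oo)%E})
  /\
  (* (iii) *)
  (forall p : R, 1 < p < 2 ->
    ('E_P[fun w => (`|X 1%N w| `^ p)%R] < +oo)%E ->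
    {ae lebesgue_measure, forall t : R, t \in `[- pi, pi[ ->
      {ae P, forall w,
        trig_sum X n t w / (n%:R `^ p^-1)%:C @[n --> \oo] --> (0 : R[i]^o)}}).
Proof.
have mX k : measurable_fun setT (X k : T -> R) by exact: measurable_funPT.
have p12W (p : R) : 1 < p < 2 -> 1 <= p < 2 by move=> /andP[/ltW -> ->].
split; [|split].
- rewrite unlock => EX.
  have X1 : (\int[P]_w (`|X 1%N w| `^ 1)%:E < +oo)%E.
    by under eq_integral do rewrite powRr1//.
  have p12 : 1 <= (1 : R) < 2 by rewrite lexx ltr1n.
  apply: ae_circle_sub (ae_trig_sum_cvg0 mX Xdom p12 X1) => t.
  rewrite invr1; apply: filterS => w.
  suff -> : (fun n => trig_sum X n t w / (n%:R `^ 1)%:C) =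
            (fun n => trig_sum X n t w / n%:R) by [].
  by apply/funext => n; rewrite powRr1// rmorph_nat.
- move=> p r p12 r1p; rewrite unlock => Xp eps eps0.
  apply: ae_circle_sub (ae_tail_series_lty mX Xdom (p12W p p12) r1p Xp eps0).
  by [].
- move=> p p12; rewrite unlock => Xp.
  apply: ae_circle_sub (ae_trig_sum_cvg0 mX Xdom (p12W p p12) Xp).
  by [].
Qed.
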